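(* Let $d\geq 2$ be an integer, let $G$ be a finite simple graph embedded in a surface of Euler characteristic $\varepsilon>0$, and let $M\geq 5d+2$ be an integer. If $\Delta(G)\leq M$, then $C_{d,1}^T(G)\leq M+2d$. In particular, if $\Delta(G)=M$ then $C_{d,1}^T(G)\leq \Delta(G)+2d$.
   Context: $\Delta(G)$ is the maximum degree of $G$. A $(d,1)$-total labelling of $G$ is an assignment $c$ of integer labels (colors) to the elements of $V(G)\cup E(G)$ such that $c(u)\neq c(v)$ whenever $uv\in E(G)$, $c(e)\neq c(e')$ whenever $e,e'$ are distinct edges sharing an endpoint, and $|c(u)-c(e)|\geq d$ whenever vertex $u$ is incident with edge $e$. Given a list $L(x)$ of integers for each $x\in V(G)\cup E(G)$, an $L$-$(d,1)$-total labelling is a $(d,1)$-total labelling $c$ with $c(x)\in L(x)$ for all $x$. $G$ is $k$-$(d,1)$-total choosable if it has an $L$-$(d,1)$-total labelling for every list assignment $L$ with $|L(x)|=k$ for all $x\in V(G)\cup E(G)$. The $(d,1)$-total choosability $C_{d,1}^T(G)$ is the minimum $k$ such that $G$ is $k$-$(d,1)$-total choosable. *)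

(* Defs.v *)
From mathcomp Require Import all_boot all_order all_algebra.
From mathcomp Require Import finmap zify boolp.

Set Implicit Arguments.
Unset Strict Implicit.
Unset Printing Implicit Defensive.

Import Order.TTheory GRing.Theory Num.Theory.

Local Open Scope nat_scope.

Record sgraph := SGraph {
  vertex :> finType;
  adj : rel vertex;
  adj_sym : symmetric adj;
  adj_irr : irreflexive adj }.

Definition edges (G : sgraph) : {set {set G}} :=
  [set [set p.1; p.2] | p : G * G & adj p.1 p.2].

Definition edge (G : sgraph) : finType := {A : {set G} | A \in edges G}.

Definition max_degree (G : sgraph) : nat :=
  \max_(x : G) #|[set y | adj x y]|.

Definition element (G : sgraph) : finType := (G + edge G)%type.

Definition total_labelling (d : nat) (G : sgraph) (c : element G -> int) : Prop :=
  [/\ forall u v : G, adj u v -> c (inl u) <> c (inl v),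
      forall a b : edge G, a <> b -> (exists2 u, u \in val a & u \in val b) ->
        c (inr a) <> c (inr b)
    & forall (u : G) (a : edge G), u \in val a ->
        (d%:Z <= `|c (inl u) - c (inr a)|)%R].

Definition list_total_labelling (d : nat) (G : sgraph)
    (L : element G -> {fset int}) (c : element G -> int) : Prop :=
  total_labelling d c /\ forall x, (c x \in L x)%fset.

Definition total_choosable (d : nat) (G : sgraph) (k : nat) : Prop :=
  forall L : element G -> {fset int}, (forall x, #|` L x|%fset = k) ->
    exists c, list_total_labelling d L c.

Lemma sparse_selection (X : finType) (d : nat) (L : X -> {fset int}) (s : seq X) :
  uniq s -> (forall x, size s * (d + d).+1 < #|` L x|%fset) ->
  exists2 c : X -> int, forall x, x \in s -> (c x \in L x)%fset &
    {in s &, forall x y, x != y -> (d%:Z < `|c x - c y|)%R}.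
Proof.
elim: s => [|x s IH] /=; first by exists (fun=> 0%R).
case/andP=> xs us hL.
have [|c cL cd] := IH us; first by move=> y; apply: leq_trans (hL y); lia.
pose bad := [seq (c y + j%:Z - d%:Z)%R | y <- s, j <- iota 0 (d + d).+1].
have [z zL zbad] : exists2 z, (z \in L x)%fset & z \notin bad.
  apply/not_exists2P => H.
  have: size (L x : seq int) <= size bad.
    apply: uniq_leq_size (fset_uniq _) _ => z zL.
    by have [/(_ zL)|/negP/negPn] := H z.
  by have := hL x; rewrite size_allpairs size_iota cardfE; lia.
have far y : y \in s -> (d%:Z < `|z - c y|)%R.
  move=> ys; rewrite ltNge; apply/negP => le.
  move/negP: zbad; apply; apply/allpairsP.
  exists (y, absz (z - c y + d%:Z)%R); split=> //; last by rewrite /=; lia.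
  by rewrite mem_iota /=; lia.
have nx y : y \in s -> (y == x) = false.
  by move=> ys; apply/eqP => yx; move: xs; rewrite -yx ys.
exists (fun y => if y == x then z else c y).
  move=> y; rewrite inE; case: eqP => [-> //|_ /=]; exact: cL.
move=> y y'; rewrite !inE.
have [->|ny] /= := eqVneq y x; have [->|ny'] /= := eqVneq y' x.
- by [].
- by move=> _ /far.
- by move=> /far h _ _; rewrite distrC.
- by move=> ys ys'; exact: cd.
Qed.

Lemma total_choosable_ex (d : nat) (G : sgraph) :
  exists k, `[< total_choosable d G k >].
Proof.
exists (#|element G| * (d + d).+1).+1; apply/asboolP => L hL.
have [|x|c cL cd] := @sparse_selection _ d L (enum (element G)).
- exact: enum_uniq.
- by rewrite hL -cardE.
have far x y : x <> y -> (d%:Z < `|c x - c y|)%R.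
  by move/eqP => ?; apply: cd; rewrite ?mem_enum.
exists c; split; last by move=> x; apply: cL; rewrite mem_enum.
have ne x y : x <> y -> c x <> c y.
  by move/far => h E; move: h; rewrite E; lia.
split.
- by move=> u v uv; apply: ne => -[E]; move: uv; rewrite E adj_irr.
- by move=> a b ab _; apply: ne => -[].
- by move=> u a _; apply/ltW/far.
Qed.

Definition total_choosability (d : nat) (G : sgraph) : nat :=
  ex_minn (total_choosable_ex d G).

(* A closed connected surface, possibly non-orientable, presented by a finite
   cell decomposition.  A flag is a mutually incident (vertex, edge, face)
   corner of the barycentric subdivision; [flip i] crosses to the neighbouring
   flag that differs only in its [i]-dimensional cell.  Freeness of the flips
   means that there is no boundary; every edge consists of four flags.  The
   1-skeleton may have loops and multiple edges. *)
Record cell_surface := CellSurface {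
  flag : finType;
  flip0 : flag -> flag;
  flip1 : flag -> flag;
  flip2 : flag -> flag;
  flip0K : involutive flip0;
  flip1K : involutive flip1;
  flip2K : involutive flip2;
  flip0_free : forall x, flip0 x <> x;
  flip1_free : forall x, flip1 x <> x;
  flip2_free : forall x, flip2 x <> x;
  flip02C : forall x, flip0 (flip2 x) = flip2 (flip0 x);
  flip02_free : forall x, flip0 (flip2 x) <> x;
  flag_gt0 : 0 < #|flag|;
  flag_connected : forall x y : flag,
    connect [rel a b | [|| b == flip0 a, b == flip1 a | b == flip2 a]] x y }.

Definition same_vertex (S : cell_surface) : rel (flag S) :=
  connect [rel a b | (b == flip1 a) || (b == flip2 a)].

Definition same_edge (S : cell_surface) : rel (flag S) :=
  connect [rel a b | (b == flip0 a) || (b == flip2 a)].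

Definition same_face (S : cell_surface) : rel (flag S) :=
  connect [rel a b | (b == flip0 a) || (b == flip1 a)].

Definition cells (S : cell_surface) (r : rel (flag S)) : {set {set flag S}} :=
  equivalence_partition r [set: flag S].

Definition euler_char (S : cell_surface) : int :=
  (#|cells (@same_vertex S)|%:Z - #|cells (@same_edge S)|%:Z
    + #|cells (@same_face S)|%:Z)%R.

(* An embedding of [G] in a closed surface is a realisation of [G] as a
   subgraph of the 1-skeleton of some cell decomposition of that surface (every
   embedded graph can be completed to such a 1-skeleton).  Hence neither [G]
   connected nor the faces of [G] being discs is required.  [p x] is a flag at
   the vertex [x]; since [G] is simple, distinct edges of [G] automatically get
   distinct edges of the 1-skeleton. *)
Definition embeds_in_surface (G : sgraph) (eps : int) : Prop :=
  exists S : cell_surface, euler_char S = eps /\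
    exists p : G -> flag S,
      (forall x y, same_vertex (p x) (p y) -> x = y) /\
      (forall x y, adj x y ->
         exists a, same_vertex (p x) a /\ same_vertex (p y) (flip0 a)).

(* Main.v *)
(** Euler's formula gives e < 3n for a simple graph on a surface of positive
    Euler characteristic and e < 2n if the graph is bipartite.  The second bound,
    applied to the edges at the vertices of degree at most 3, 4 and 5, combines
    with the first into a light edge [uv]: one with d(u) <= 2, or d(u) <= 3 and
    d(v) <= 11, or d(u) + d(v) <= 11.  Delete [uv], label the rest by induction and
    count forbidden labels: an edge loses 2d - 1 labels to each labelled end,
    and u loses at most 2d labels to each of its edges.  If d(u) <= 4, then u has
    room to be relabelled; if d(u) >= 5, both ends keep their labels, so they have
    to be kept distinct after the deletion.  Hence the induction is on pairs of
    graphs, one carrying the vertex constraints and a smaller one the edges still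
    to be labelled, which differ only at vertices of degree at most 6. *)

Require Import Defs.
From mathcomp Require Import all_boot all_order all_algebra.
From mathcomp Require Import finmap zify boolp.

Set Implicit Arguments.
Unset Strict Implicit.
Unset Printing Implicit Defensive.

Import Order.TTheory GRing.Theory Num.Theory.

Local Open Scope nat_scope.

(** * Involutions, fibres and classes *)

(** [A] splits into two-element orbits [{x, f x}], removed one at a time. *)
Lemma free_involution_even (X : finType) (f : X -> X) (A : {set X}) :
  involutive f -> (forall x, f x <> x) -> (forall x, x \in A -> f x \in A) ->
  ~~ odd #|A|.
Proof.
move=> fK f_free; have [n] := ubnP #|A|; elim: n A => // n IH A ltA fA.
have [->|[x xA]] := set_0Vmem A; first by rewrite cards0.
have fxA : f x \in A :\ x by rewrite !inE fA // andbT; apply/eqP.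
rewrite (cardsD1 x) xA (cardsD1 (f x) (A :\ x)) fxA /= negbK; apply: IH.
  by move: ltA; rewrite (cardsD1 x) xA (cardsD1 (f x) (A :\ x)) fxA; lia.
move=> y; rewrite !inE (can_eq fK) => /and3P[yfx yx yA].
by rewrite yx fA // andbT /= -(can_eq fK) fK.
Qed.

(** [h] picks a point of [A] in each fibre of [f], so [g] factors through [f] on [A]; the option
    type covers the empty fibres. *)
Lemma leq_card_imset_factor (X Y Z : finType) (f : X -> Y) (g : X -> Z)
    (A : {set X}) :
  {in A &, forall a b, f a = f b -> g a = g b} -> #|g @: A| <= #|f @: A|.
Proof.
move=> fg; pose h y := [pick x in A | f x == y].
have hP a : a \in A -> exists2 b, h (f a) = Some b & g b = g a.
  rewrite /h => aA; case: pickP => [b /andP[bA /eqP fb]|/(_ a)].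
    by exists b => //; exact: fg.
  by rewrite /= aA eqxx.
pose k y := omap g (h y).
have -> : #|g @: A| = #|Some @: (g @: A)| by rewrite (card_imset _ (@Some_inj _)).
apply: leq_trans (leq_imset_card k (f @: A)); apply/subset_leq_card/subsetP.
move=> _ /imsetP[_ /imsetP[a aA ->] ->].
by apply/imsetP; exists (f a); rewrite ?imset_f // /k; have [b -> <-] := hP a aA.
Qed.

Lemma card_fibers (X Y : finType) (f : X -> Y) (F : {set X}) :
  #|F| = \sum_(y in f @: [set: X]) #|[set b in F | f b == y]|.
Proof.
rewrite -sum1_card (partition_big f (fun y => y \in f @: [set: X])) /=.
  by apply: eq_bigr => y _; rewrite -sum1_card; apply: eq_bigl => b; rewrite inE.
by move=> b _; rewrite imset_f.
Qed.

Lemma leq_mul_fibers (X Y : finType) (f : X -> Y) (F : {set X}) m :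
  (forall x, m <= #|[set b in F | f b == f x]|) ->
  m * #|f @: [set: X]| <= #|F|.
Proof.
move=> le_m; rewrite (card_fibers f F) mulnC -sum_nat_const.
by apply: leq_sum => _ /imsetP[x _ ->].
Qed.

Lemma geq_mul_fibers (X Y : finType) (f : X -> Y) m :
  (forall x, #|[set b | f b == f x]| <= m) -> #|X| <= m * #|f @: [set: X]|.
Proof.
move=> le_m; rewrite -cardsT (card_fibers f) mulnC -sum_nat_const.
apply: leq_sum => _ /imsetP[x _ ->]; apply: leq_trans (le_m x).
by apply/subset_leq_card/subsetP => b; rewrite !inE.
Qed.

(** Written in the shape used by [equivalence_partition], so that its images match the classes
    counted by [cells]. *)
Definition cls (X : finType) (r : rel X) (x : X) := [set y in [set: X] | r x y].

Lemma cls_eqE (X : finType) (e : rel X) a b :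
  symmetric e -> (cls (connect e) a == cls (connect e) b) = connect e a b.
Proof.
move=> e_sym; have csym := sym_connect_sym e_sym.
apply/eqP/idP => [/setP/(_ b)|ab]; first by rewrite !inE connect0.
by apply/setP => y; rewrite !inE; exact: same_connect.
Qed.

(** * Euler's formula for subgraphs of the 1-skeleton *)

Section Surface.

Variable S : cell_surface.
Implicit Types (a b x y : flag S) (F : {set flag S}).

Notation f0 := (@flip0 S).
Notation f1 := (@flip1 S).
Notation f2 := (@flip2 S).

Definition vertex_step : rel (flag S) := [rel a b | (b == f1 a) || (b == f2 a)].

Lemma invol_eq_sym (f : flag S -> flag S) a b :
  involutive f -> (b == f a) = (a == f b).
Proof. by move=> fK; rewrite -(can_eq fK) fK eq_sym. Qed.

Lemma vertex_step_sym : symmetric vertex_step.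
Proof.
by move=> a b; rewrite /vertex_step /= (invol_eq_sym _ _ (@flip1K S)) (invol_eq_sym _ _ (@flip2K S)).
Qed.

Lemma same_vertex_sym : symmetric (@same_vertex S).
Proof. exact: sym_connect_sym vertex_step_sym. Qed.

Lemma same_vertex_trans : transitive (@same_vertex S).
Proof. exact: connect_trans. Qed.

Lemma same_vertex0 x : same_vertex x x.
Proof. exact: connect0. Qed.

Lemma same_vertexr1 x y : same_vertex x (f1 y) = same_vertex x y.
Proof.
have st z : same_vertex z (f1 z) by apply: connect1; rewrite /= eqxx.
apply/idP/idP => h; apply: same_vertex_trans h _; last exact: st.
by have := st (f1 y); rewrite flip1K.
Qed.

Lemma same_vertexr2 x y : same_vertex x (f2 y) = same_vertex x y.
Proof.
have st z : same_vertex z (f2 z) by apply: connect1; rewrite /= eqxx orbT.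
apply/idP/idP => h; apply: same_vertex_trans h _; last exact: st.
by have := st (f2 y); rewrite flip2K.
Qed.

Lemma flags_connected (A : {set flag S}) x y :
  (forall z, z \in A -> f0 z \in A) -> (forall z, z \in A -> f1 z \in A) ->
  (forall z, z \in A -> f2 z \in A) -> x \in A -> y \in A.
Proof.
move=> A0 A1 A2 xA; have := flag_connected x y => /(closed_connect _) <- //.
apply: intro_closed => [|u v /or3P[]/eqP-> //]; try by auto.
apply: sym_connect_sym => u v /=.
by rewrite !(@invol_eq_sym _ u v) //; [exact: flip2K | exact: flip1K | exact: flip0K].
Qed.

(* When [F] is the set of flags of the edges of an embedded graph, the regions
   are the components of its complement in the surface. *)
Definition region_step F : rel (flag S) :=
  [rel a b | [|| b == f0 a, b == f1 a | (a \notin F) && (b == f2 a)]].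

Definition region F := connect (region_step F).

(** An orbit under [flip0] and [flip2] is the set of flags of one edge, so such an [F] consists of
    whole edges. *)
Definition edge_closed F :=
  (forall x, (f0 x \in F) = (x \in F)) /\ (forall x, (f2 x \in F) = (x \in F)).

Lemma region_step_sym F : edge_closed F -> symmetric (region_step F).
Proof.
case=> _ F2 a b; rewrite /region_step /= (invol_eq_sym _ _ (@flip0K S)) (invol_eq_sym _ _ (@flip1K S)).
rewrite (invol_eq_sym _ _ (@flip2K S)); do 2!congr (_ || _).
by case: (eqVneq a (f2 b)) => [->|]; rewrite ?andbF // F2.
Qed.

Section Regions.

Variable F : {set flag S}.
Hypothesis F_closed : edge_closed F.

Lemma region_sym : symmetric (region F).
Proof. exact: sym_connect_sym (region_step_sym F_closed). Qed.

Lemma region_trans : transitive (region F).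
Proof. exact: connect_trans. Qed.

Lemma region0 x : region F x x.
Proof. exact: connect0. Qed.

Lemma regionr0 x y : region F x y -> region F x (f0 y).
Proof. by move/region_trans; apply; apply: connect1; rewrite /region_step /= eqxx. Qed.

Lemma regionr1 x y : region F x y -> region F x (f1 y).
Proof. by move/region_trans; apply; apply: connect1; rewrite /region_step /= eqxx orbT. Qed.

Lemma regionr2 x y : y \notin F -> region F x y -> region F x (f2 y).
Proof.
by move=> yF /region_trans; apply; apply: connect1; rewrite /region_step /= yF eqxx !orbT.
Qed.

Lemma region_ind (P : pred (flag S)) x y :
  (forall z, P z -> P (f0 z)) -> (forall z, P z -> P (f1 z)) ->
  (forall z, z \notin F -> P z -> P (f2 z)) -> P x -> region F x y -> P y.
Proof.
move=> P0 P1 P2 Px xy; suff : closed (region_step F) P.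
  by move/closed_connect/(_ x y xy); rewrite -!topredE /= Px => <-.
apply: intro_closed; first exact: sym_connect_sym (region_step_sym F_closed).
move=> u v /or3P[/eqP->|/eqP->|/andP[uF /eqP->]].
- exact: P0.
- exact: P1.
- exact: P2.
Qed.

(* [flip1] pairs up all the flags of the set, and [flip2] those not in [F]. *)
Lemma region_vertex_even (V : pred (flag S)) x :
  (forall y, V (f1 y) = V y) -> (forall y, V (f2 y) = V y) ->
  ~~ odd #|[set b in F | V b && region F x b]|.
Proof.
move=> V1 V2; pose A := [set b | V b && region F x b].
have evA : ~~ odd #|A|.
  apply: free_involution_even (@flip1K S) (@flip1_free S) _ => b.
  by rewrite !inE V1 => /andP[-> /regionr1].
have evD : ~~ odd #|A :\: F|.
  apply: free_involution_even (@flip2K S) (@flip2_free S) _ => b.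
  rewrite !inE V2 F_closed.2 => /and3P[bF -> xb]; rewrite bF /=; exact: regionr2.
have -> : [set b in F | V b && region F x b] = A :&: F.
  by apply/setP => b; rewrite !inE andbC.
by move: evA; rewrite -(cardsID F A) oddD (negbTE evD) addbF.
Qed.

(** By parity, [x] cannot be the only flag of [F] at its vertex and in its region: the boundary of
    the region continues there. *)
Lemma region_next x : x \in F ->
  exists y, [/\ y \in F, same_vertex x y, region F x y & y != x].
Proof.
move=> xF; have := @region_vertex_even (same_vertex x) x.
move/(_ (same_vertexr1 x) (same_vertexr2 x)).
rewrite (cardsD1 x) inE xF same_vertex0 region0 /= negbK => od.
have [E|[y]] := set_0Vmem ([set b in F | same_vertex x b && region F x b] :\ x).
  by move: od; rewrite E cards0.
by rewrite !inE => /andP[yx /and3P[yF xy rxy]]; exists y.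
Qed.

(** A region free of flags of [F] would be closed under all three flips, hence be the whole
    connected surface. *)
Lemma region_meets x : F != set0 -> exists2 y, y \in F & region F x y.
Proof.
case/set0Pn => y yF.
have [E|[z]] := set_0Vmem [set z in F | region F x z]; last first.
  by rewrite inE => /andP[zF xz]; exists z.
have notF z : region F x z -> z \notin F.
  move=> xz; apply/negP => zF.
  have : z \in [set z in F | region F x z] by rewrite inE zF.
  by rewrite E inE.
have : y \in [set z | region F x z].
  apply: (@flags_connected _ x); rewrite ?inE ?region0 // => z; rewrite !inE.
  - exact: regionr0.
  - exact: regionr1.
  - by move=> xz; apply: regionr2; rewrite ?notF.
by rewrite inE => /notF; rewrite yF.
Qed.

(** No loops, then no parallel edges: only the two sides [a] and [f2 a] of one edge share an ordered
    pair of ends. *)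
Definition simple_flags :=
  (forall a, a \in F -> ~~ same_vertex a (f0 a)) /\
  (forall a b, a \in F -> b \in F -> same_vertex a b ->
     same_vertex (f0 a) (f0 b) -> b = a \/ b = f2 a).

(** Two flags make one side of an edge, so the boundary of a region has length at least three.
    [region_next] at both ends of an edge yields four flags, and their number is even. Were there
    only four, they would be the two sides of a single edge; the region would be the whole surface
    and [F] that edge alone. *)
Lemma region_size x : simple_flags -> 4 < #|F| ->
  6 <= #|[set b in F | region F x b]|.
Proof.
case=> noloop simpleF F4; set R := [set b in F | region F x b].
have [b bF xb] : exists2 y, y \in F & region F x y.
  by apply: region_meets; rewrite -card_gt0; lia.
have R0 z : z \in R -> f0 z \in R.
  by rewrite !inE F_closed.1 => /andP[-> /regionr0].
have evR : ~~ odd #|R| by exact: free_involution_even (@flip0K S) (@flip0_free S) R0.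
have bR : b \in R by rewrite inE bF.
have toR z y : z \in R -> y \in F -> region F z y -> y \in R.
  by rewrite !inE => /andP[_ xz] -> /(region_trans xz).
have [y [yF by_ rby yb]] := region_next bF.
have b0F : f0 b \in F by rewrite F_closed.1.
have [y' [y'F by' rby' y'b]] := region_next b0F.
have yR : y \in R by exact: toR rby.
have y'R : y' \in R by apply: toR rby' => //; exact: R0.
have nV z z' : same_vertex b z -> same_vertex (f0 b) z' -> z != z'.
  move=> bz bz'; apply: contraNneq (noloop b bF) => E.
  by apply: same_vertex_trans bz _; rewrite same_vertex_sym E.
have uQ : uniq [:: b; f0 b; y; y'].
  rewrite /= !inE !negb_or nV ?same_vertex0 // eq_sym yb nV ?same_vertex0 //.
  by rewrite eq_sym nV ?same_vertex0 // eq_sym y'b nV.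
have sQ : {subset [:: b; f0 b; y; y'] <= enum R}.
  by apply/allP; rewrite /= !mem_enum bR R0 // yR y'R.
have ge4 := uniq_leq_size uQ sQ; rewrite /= -cardE in ge4.
case: (ltnP #|R| 6) => // lt6.
have {lt6 ge4} R4 : #|R| = 4 by move: evR; case: #|R| lt6 ge4 => [|[|[|[|[|[|]]]]]].
have memR : enum R =i [:: b; f0 b; y; y'].
  have le4 : size (enum R) <= 4 by rewrite -cardE R4.
  by have [_ E] := uniq_min_size uQ sQ le4; move=> z; rewrite E.
have E : f0 y = y'.
  have := R0 _ yR; rewrite -mem_enum memR !inE => /or4P[/eqP E|/eqP E|/eqP E|/eqP //].
  - by have /eqP[] := nV y (f0 b) by_ (same_vertex0 _); rewrite -E flip0K.
  - by move: yb; rewrite -(flip0K y) E flip0K eqxx.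
  - by case: (@flip0_free S y).
have Ey : y = f2 b.
  have sv : same_vertex (f0 b) (f0 y) by rewrite E.
  by have [Eb|//] := simpleF b y bF yF by_ sv; rewrite Eb eqxx in yb.
have R2 z : z \in R -> f2 z \in R.
  move=> zR; rewrite -mem_enum memR; move: zR; rewrite -mem_enum memR !inE.
  rewrite -E Ey flip02C => /or4P[] /eqP->; rewrite ?flip2K ?eqxx ?orbT //.
have : #|F| <= #|R|.
  apply/subset_leq_card/subsetP => z zF.
  have : z \in [set z | region F x z].
    apply: (@flags_connected _ b); rewrite ?inE // => w; rewrite !inE.
    - exact: regionr0.
    - exact: regionr1.
    - case: (boolP (w \in F)) => wF xw; last exact: regionr2.
      by have := R2 w; rewrite !inE wF xw => /(_ isT) /andP[].
  by rewrite !inE zF.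
by rewrite R4 leqNgt F4.
Qed.

Definition region_count := #|cls (region F) @: [set: flag S]|.

Lemma fiber_region x :
  [set b in F | cls (region F) b == cls (region F) x] = [set b in F | region F x b].
Proof.
by apply/setP => b; rewrite !inE cls_eqE; [rewrite -/(region F) region_sym | exact: region_step_sym].
Qed.

Lemma region_count_simple : simple_flags -> 4 < #|F| -> 6 * region_count <= #|F|.
Proof.
move=> sF F4; apply: leq_mul_fibers => x; rewrite fiber_region; exact: region_size.
Qed.

(** The boundary flags at the vertices of [V] are even in number and [flip0] matches them with the
    others. So a region has a multiple of four boundary flags, and at least six, hence eight. *)
Lemma region_count_bipartite (V : pred (flag S)) :
  (forall y, V (f1 y) = V y) -> (forall y, V (f2 y) = V y) ->
  (forall y, y \in F -> V (f0 y) = ~~ V y) ->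
  simple_flags -> 4 < #|F| -> 8 * region_count <= #|F|.
Proof.
move=> V1 V2 V0 sF F4; apply: leq_mul_fibers => x; rewrite fiber_region.
have := region_size x sF F4; set R := [set b in F | _].
have ev := region_vertex_even x V1 V2; set RV := [set b in F | _] in ev.
have -> : #|R| = #|RV|.*2.
  rewrite -(cardsID [set b | V b] R) -addnn.
  have -> : R :&: [set b | V b] = RV.
    by apply/setP => b; rewrite !inE -!andbA; congr (_ && _); rewrite andbC.
  have -> : R :\: [set b | V b] = f0 @: RV; last first.
    by rewrite card_imset //; exact: (can_inj (@flip0K S)).
  apply/setP => b; apply/idP/imsetP => [|[c]]; rewrite !inE.
    case/and3P => Vb bF xb; exists (f0 b); rewrite ?flip0K // !inE.
    by rewrite F_closed.1 bF V0 // Vb regionr0.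
  by case/and3P => cF Vc xc ->; rewrite F_closed.1 cF V0 // Vc regionr0.
by move: ev; set n := #|RV|; move=> ev; have := odd_double_half n; lia.
Qed.

End Regions.

(** * Adding an edge to a subgraph of the 1-skeleton *)

Definition vertex_count F := #|cls (@same_vertex S) @: F|.

Definition add_edge F x := [set x; f0 x; f2 x; f0 (f2 x)] :|: F.

Lemma add_edge_closed F x : edge_closed F -> edge_closed (add_edge F x).
Proof.
case=> F0 F2; split=> y; rewrite !inE ?F0 ?F2; congr (_ || _).
  rewrite !(can2_eq (@flip0K S) (@flip0K S)) !flip0K.
  by case: (y == x); case: (y == f0 x); case: (y == f2 x); case: (y == _).
rewrite !(can2_eq (@flip2K S) (@flip2K S)) -!flip02C !flip2K.
by case: (y == x); case: (y == f0 x); case: (y == f2 x); case: (y == _).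
Qed.

Lemma card_add_edge F x : edge_closed F -> x \notin F ->
  #|add_edge F x| = #|F| + 4.
Proof.
case=> F0 F2 xF; rewrite /add_edge cardsU.
have -> : [set x; f0 x; f2 x; f0 (f2 x)] :&: F = set0.
  apply/setP => y; rewrite !inE; apply/negbTE/negP => /andP[+ yF].
  rewrite -!orbA => /or4P[] /eqP E; move: yF; rewrite E ?F0 ?F2 ?F0 //;
    rewrite ?F2; exact/negP.
rewrite cards0 subn0 addnC; congr (_ + _).
have ne f : (forall x, f x <> x) -> forall z : flag S, (z == f z) = false.
  by move=> fr z; rewrite eq_sym; apply/eqP.
have n0 := ne _ (@flip0_free S); have n2 := ne _ (@flip2_free S).
have n02 := ne _ (@flip02_free S).
have n02' : (f0 x == f2 x) = false.
  by rewrite -(can_eq (@flip0K S)) flip0K n02.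
rewrite -!setUA !cardsU1 cards1 !inE n0 n2 n02 n02' flip02C n2 -flip02C n0.
by [].
Qed.

(** The hypothesis provides a detour wherever [F'] blocks a crossing that [F] allows. *)
Lemma region_sub F F' x y : edge_closed F ->
  (forall z, z \notin F -> z \in F' -> region F' z (f2 z)) ->
  region F x y -> region F' x y.
Proof.
move=> cF h; apply: region_ind (region0 F' x) => // z.
- exact: regionr0.
- exact: regionr1.
- move=> zF; case: (boolP (z \in F')) => zF' xz; last exact: regionr2.
  by apply: region_trans xz _; exact: h.
Qed.

(** Flags separated only by the new edge lie in the regions of its two sides [x] and [f2 x]; this is
    [P]. Once the region of [f2 x] is set aside by [A], the other regions of [F'] lie in distinct
    regions of [F]. *)
Lemma region_count_add_edge F x : edge_closed F ->
  region_count (add_edge F x) <= (region_count F).+1.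
Proof.
move=> cF; set F' := add_edge F x.
have cF' : edge_closed F' by exact: add_edge_closed.
have rs := region_sym cF'; have rt := @region_trans F'.
pose P a b := [|| region F' a b, region F' a x && region F' (f2 x) b
                | region F' a (f2 x) && region F' x b].
have sub a b : region F a b -> P a b.
  apply: (region_ind cF (P := P a)); rewrite /P ?region0 //.
  - by move=> z /or3P[|/andP[->]|/andP[->]] /regionr0 ->; rewrite ?orbT.
  - by move=> z /or3P[|/andP[->]|/andP[->]] /regionr1 ->; rewrite ?orbT.
  move=> z zF; case: (boolP (z \in F')) => zF'; last first.
    by move=> /or3P[|/andP[->]|/andP[->]] /(regionr2 zF') ->; rewrite ?orbT.
  have [[zx zx2]|[zx zx2]] : (region F' z x /\ region F' (f2 x) (f2 z)) \/
      (region F' z (f2 x) /\ region F' x (f2 z)).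
    have r0 := region0 F'; have r00 w : region F' (f0 w) w.
      by rewrite rs; exact: regionr0.
    move: zF'; rewrite !inE (negbTE zF) orbF -!orbA => /or4P[] /eqP->.
    - by left; rewrite !r0.
    - by left; rewrite r00 -flip02C regionr0.
    - by right; rewrite flip2K !r0.
    - by right; rewrite r00 -flip02C flip2K regionr0.
  - case/or3P => [az|/andP[ax _]|/andP[ax _]].
    + by rewrite (rt _ _ _ az zx) zx2 !orbT.
    + by rewrite ax zx2 !orbT.
    + by rewrite (rt _ _ _ ax zx2).
  - case/or3P => [az|/andP[ax _]|/andP[ax _]].
    + by rewrite (rt _ _ _ az zx) zx2 !orbT.
    + by rewrite (rt _ _ _ ax zx2).
    + by rewrite ax zx2 !orbT.
pose A := [set b | ~~ region F' (f2 x) b].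
have leA : #|cls (region F') @: A| <= #|cls (region F) @: A|.
  apply: leq_card_imset_factor => a b; rewrite !inE => na nb /eqP.
  rewrite cls_eqE ?(negbTE nb) => [/sub|]; last exact: region_step_sym.
  rewrite /P (negbTE nb) andbF rs /=; case/orP=> [ba|/andP[]].
    by apply/eqP; rewrite cls_eqE ?[connect _ _ _]rs //; exact: region_step_sym.
  by rewrite rs (negbTE na).
have subA : cls (region F') @: [set: flag S] \subset
    cls (region F') (f2 x) |: cls (region F') @: A.
  apply/subsetP => _ /imsetP[b _ ->]; rewrite in_setU1.
  case: (boolP (region F' (f2 x) b)) => h; last by rewrite imset_f ?orbT ?inE.
  by rewrite cls_eqE ?[connect _ _ _]rs ?h //; exact: region_step_sym.
apply: leq_trans (subset_leq_card subA) _; rewrite cardsU1.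
apply: leq_trans (leq_add (leq_b1 _) leA) _; rewrite add1n ltnS.
by apply/subset_leq_card/imsetS; exact: subsetT.
Qed.

(** At the new vertex, that of [f0 x], the only flags of [F'] are those of the new edge. By parity
    its two sides lie in one region, so a crossing of the edge can be replaced by a way round its
    free end. *)
Lemma region_count_add_pendant F x : edge_closed F -> x \notin F ->
  ~~ same_vertex x (f0 x) -> (forall y, y \in F -> ~~ same_vertex (f0 x) y) ->
  region_count (add_edge F x) <= region_count F.
Proof.
move=> cF xF nl nF; set F' := add_edge F x.
have cF' : edge_closed F' by exact: add_edge_closed.
have rs := region_sym cF'.
have nl' z : same_vertex x z -> same_vertex (f0 x) z = false.
  move=> xz; apply: contraNF nl => h.
  by apply: same_vertex_trans xz _; rewrite same_vertex_sym.
have r02 : region F' (f0 x) (f2 (f0 x)).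
  have := region_vertex_even cF' (f0 x) (same_vertexr1 (f0 x)) (same_vertexr2 (f0 x)).
  apply: contraNT => nr; suff -> : [set b in F' | same_vertex (f0 x) b &&
    region F' (f0 x) b] = [set f0 x] by rewrite cards1.
  apply/setP => b; rewrite !inE -!orbA; apply/idP/eqP => [|->]; last first.
    by rewrite eqxx orbT same_vertex0 region0.
  case/and3P => + vb rb; case/or4P => [/eqP E|/eqP //|/eqP E|/orP[/eqP E|bF]].
  - by move: vb; rewrite E nl' ?same_vertex0.
  - by move: vb; rewrite E nl' // same_vertexr2 same_vertex0.
  - by move: rb; rewrite E flip02C (negbTE nr).
  - by move: (nF b bF); rewrite vb.
apply: leq_card_imset_factor => a b _ _ /eqP.
rewrite cls_eqE; last exact: region_step_sym.
move=> /(@region_sub F F' _ _ cF) h; apply/eqP.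
rewrite cls_eqE; last exact: region_step_sym.
apply: h => z zF; rewrite !inE (negbTE zF) orbF -!orbA.
have rx : region F' x (f2 x).
  apply: region_trans (regionr0 (region0 F' x)) _.
  by rewrite -(flip0K (f2 x)) flip02C regionr0.
by case/or4P => /eqP->; rewrite ?[f0 (f2 x)]flip02C ?flip2K //; rewrite rs.
Qed.

Lemma card_flags_edges : #|flag S| <= 4 * #|cells (@same_edge S)|.
Proof.
apply: (geq_mul_fibers (f := cls (@same_edge S))) => x.
have es : symmetric [rel a b : flag S | (b == f0 a) || (b == f2 a)].
  move=> a b /=; by rewrite (invol_eq_sym _ _ (@flip0K S)) (invol_eq_sym _ _ (@flip2K S)).
apply: leq_trans (_ : #|add_edge set0 x| <= 4); last first.
  rewrite card_add_edge ?cards0 ?inE //; split=> y; by rewrite !inE.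
apply/subset_leq_card/subsetP => b; rewrite inE cls_eqE // -/(@same_edge S) => h.
have [c0 c2] : edge_closed (add_edge set0 x) by apply: add_edge_closed; split=> y; rewrite !inE.
rewrite -(closed_connect _ (_ : same_edge x b)) ?inE ?eqxx //.
  by apply: intro_closed => [|u v /orP[]/eqP-> //]; rewrite ?c0 ?c2 //; exact: sym_connect_sym.
by rewrite /same_edge sym_connect_sym.
Qed.

(* Induction on the number of missing edges: an edge sharing a vertex with [F]
   is added, and it either leaves the set of covered vertices unchanged and
   splits at most one region, or covers a new vertex and splits none. *)
Lemma euler_flags F : edge_closed F -> F != set0 ->
  (4 * euler_char S <=
   4 * (vertex_count F)%:Z - #|F|%:Z + 4 * (region_count F)%:Z)%R.
Proof.
have [n] := ubnP #|~: F|; elim: n F => // n IH F ltn cF F0.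
pose C := [set b | [exists c in F, same_vertex c b]].
have subC : F \subset C.
  by apply/subsetP => b bF; rewrite inE; apply/existsP; exists b; rewrite bF same_vertex0.
(* If all flags at covered vertices are in [F], connectedness makes [F] the set of all flags. Its
   regions are then the faces, and [card_flags_edges] gives the bound. *)
case: (boolP (C \subset F)) => [CF|/subsetPn[x xC xF]].
  have EF : F = setT.
    apply/setP => y; rewrite inE; case/set0Pn: F0 => x xF.
    apply: (@flags_connected _ x) => // z; rewrite ?cF.1 ?cF.2 // => zF.
    apply: (subsetP CF); rewrite inE; apply/existsP; exists z.
    by rewrite zF same_vertexr1 same_vertex0.
  have := card_flags_edges; rewrite EF cardsT /euler_char.
  have -> : vertex_count [set: flag S] = #|cells (@same_vertex S)| by [].
  suff -> : region_count [set: flag S] = #|cells (@same_face S)|.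
    by lia.
  rewrite /region_count /cells /equivalence_partition.
  congr #|pred_of_set _|; apply: eq_imset => a; apply/setP => b; rewrite !inE /=.
  by apply: eq_connect => u v; rewrite /region_step /= in_setT orbF.
set F' := add_edge F x; have cF' : edge_closed F' by exact: add_edge_closed.
have cardF' : #|F'| = #|F| + 4 by exact: card_add_edge.
have /IH-/(_ cF') : #|~: F'| < n.
  by have := cardsC F; have := cardsC F'; lia.
have -> : F' != set0 by rewrite -card_gt0 cardF' addn4.
move=> /(_ isT).
have clsE a b : (cls (@same_vertex S) a == cls (@same_vertex S) b) = same_vertex a b.
  exact: cls_eqE vertex_step_sym.
have inF b : b \in C -> cls (@same_vertex S) b \in cls (@same_vertex S) @: F.
  rewrite inE => /existsP[c /andP[cF'' cb]]; apply/imsetP; exists c => //.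
  by apply/eqP; rewrite clsE same_vertex_sym.
have C2 b : (f2 b \in C) = (b \in C).
  by rewrite !inE; apply: eq_existsb => c; rewrite same_vertexr2.
case: (boolP (f0 x \in C)) => x0C.
  have : vertex_count F' <= vertex_count F.
    apply/subset_leq_card/subsetP => _ /imsetP[b bF' ->]; apply: inF.
    move: bF'; rewrite !inE -!orbA => /or4P[/eqP->|/eqP->|/eqP->|/orP[/eqP->|bF]].
    - by move: xC; rewrite inE.
    - by move: x0C; rewrite inE.
    - by move: xC; rewrite -C2 inE.
    - by move: x0C; rewrite -C2 flip02C inE.
    - by move/subsetP/(_ _ bF): subC; rewrite inE.
  have := region_count_add_edge x cF; rewrite -/F' cardF'.
  by move=> h1 h2 h3; apply: (le_trans h3); lia.
have nl : ~~ same_vertex x (f0 x).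
  apply: contra x0C => xx0; move: xC; rewrite !inE => /existsP[c /andP[cF'' cx]].
  by apply/existsP; exists c; rewrite cF'' (same_vertex_trans cx).
have nF y : y \in F -> ~~ same_vertex (f0 x) y.
  move=> yF; apply: contra x0C => h; rewrite inE; apply/existsP; exists y.
  by rewrite yF same_vertex_sym.
have : vertex_count F' <= (vertex_count F).+1.
  apply: leq_trans (_ : #|cls (@same_vertex S) (f0 x) |: cls (@same_vertex S) @: F| <= _).
    apply/subset_leq_card/subsetP => _ /imsetP[b bF' ->]; rewrite in_setU1.
    move: bF'; rewrite !inE -!orbA => /or4P[/eqP->|/eqP->|/eqP->|/orP[/eqP->|bF]].
    - by rewrite inF ?orbT.
    - by rewrite eqxx.
    - by rewrite inF ?orbT ?C2.
    - by rewrite clsE same_vertex_sym flip02C same_vertexr2 same_vertex0.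
    - by rewrite imset_f ?orbT.
  by rewrite cardsU1 -addn1 addnC leq_add2l leq_b1.
have := region_count_add_pendant cF xF nl nF; rewrite -/F' cardF'.
by move=> h1 h2 h3; apply: (le_trans h3); lia.
Qed.

End Surface.

(** * Light edges of embedded graphs *)

Section Graphs.

Variable T : finType.
Implicit Types (e : rel T) (u v x y z : T).

Definition degree e x := #|[set y | e x y]|.

Definition arcs e := [set q : T * T | e q.1 q.2].

Definition nonisolated e := [set x | 0 < degree e x].

Lemma card_arcs e : #|arcs e| = \sum_x degree e x.
Proof.
rewrite -sum1_card (partition_big (fun q => q.1) predT) //=.
apply: eq_bigr => x _; rewrite /degree -(card_imset _ (_ : injective (pair x))).
  rewrite -sum1_card; apply: eq_bigl => -[a b]; rewrite !inE /=.
  apply/andP/imsetP => [[ab /eqP <-]|[c]]; first by exists b; rewrite ?inE.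
  by rewrite inE => xc [-> ->].
by move=> ? ? [].
Qed.

Lemma degree_gt0 e x y : e x y -> 0 < degree e x.
Proof. by move=> xy; rewrite card_gt0; apply/set0Pn; exists y; rewrite inE. Qed.

Lemma leq_degree e e' x : subrel e e' -> degree e x <= degree e' x.
Proof. by move=> h; apply/subset_leq_card/subsetP => y; rewrite !inE; exact: h. Qed.

(** Relations on a fixed type replace [sgraph], so that edges can be deleted while the vertices stay
    the same. *)
Definition embeds_pos e :=
  exists S : cell_surface, (0 < euler_char S)%R /\
    exists p : T -> flag S,
      (forall x y, same_vertex (p x) (p y) -> x = y) /\
      (forall x y, e x y ->
         exists a, same_vertex (p x) a /\ same_vertex (p y) (flip0 a)).

Lemma embeds_pos_sub e e' : subrel e e' -> embeds_pos e' -> embeds_pos e.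
Proof.
move=> h [S [S0 [p [p_inj pe]]]]; exists S; split=> //; exists p; split=> //.
by move=> x y /h /pe.
Qed.

Lemma arc_flags e (S : cell_surface) (p : T -> flag S) :
  symmetric e -> irreflexive e ->
  (forall x y, e x y ->
     exists a, same_vertex (p x) a /\ same_vertex (p y) (flip0 a)) ->
  exists h : T -> T -> flag S, forall x y, e x y ->
    [/\ same_vertex (p x) (h x y), same_vertex (p y) (flip0 (h x y))
      & h y x = flip0 (h x y)].
Proof.
move=> e_sym e_irr pe.
have [g gP] : exists g : T -> T -> flag S, forall x y, e x y ->
    same_vertex (p x) (g x y) /\ same_vertex (p y) (flip0 (g x y)).
  exists (fun x y => odflt (p x)
    [pick a | same_vertex (p x) a && same_vertex (p y) (flip0 a)]) => x y /pe[a [xa ya]].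
  by case: pickP => [b /andP[]|/(_ a)] //=; rewrite xa ya.
(* Of the flags chosen for [xy] and [yx] one is kept, by the order of enumeration, and the other is
   redefined as its flip; both arcs then run along the same edge of the surface. *)
exists (fun x y => if enum_rank x < enum_rank y then g x y else flip0 (g y x)).
move=> x y xy; have yx : e y x by rewrite e_sym.
have [xg yg] := gP _ _ xy; have [yg' xg'] := gP _ _ yx.
case: (ltngtP (enum_rank x) (enum_rank y)) => [||/val_inj/enum_rank_inj E].
- by [].
- by rewrite flip0K.
- by rewrite E e_irr in xy.
Qed.

(** An arc carries two flags, one for each side. Inserting the bounds of six or eight flags per
    region into [euler_flags] gives e < 3n or e < 2n; as arcs count edges twice, the constants are 6
    and 4. *)
Lemma embedded_arcs e : symmetric e -> irreflexive e -> embeds_pos e ->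
  0 < #|arcs e| ->
  #|arcs e| < 6 * #|nonisolated e| /\
  forall s : pred T, (forall x y, e x y -> s y = ~~ s x) ->
    #|arcs e| < 4 * #|nonisolated e|.
Proof.
move=> e_sym e_irr [S [S0 [p [p_inj pe]]]] D0.
have N0 : 0 < #|nonisolated e|.
  case/card_gt0P: D0 => -[x y]; rewrite inE /= => /degree_gt0 h.
  by apply/card_gt0P; exists x; rewrite inE.
(* A single edge is treated apart, since the region bounds require more than four flags. *)
case: (leqP #|arcs e| 2) => [D2|D3]; first by split=> [|s _]; lia.
have [h hP] := arc_flags e_sym e_irr pe.
have sv := @same_vertex_sym S; have st := @same_vertex_trans S.
have p_inj2 x y b : same_vertex (p x) b -> same_vertex (p y) b -> x = y.
  by move=> xb yb; apply: p_inj; apply: st xb _; rewrite sv.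
have f20 (b a : flag S) : same_vertex a (flip0 (flip2 b)) = same_vertex a (flip0 b).
  by rewrite flip02C same_vertexr2.
pose k (q : T * T * bool) :=
  if q.2 then flip2 (h q.1.1 q.1.2) else h q.1.1 q.1.2.
pose D := [set q : T * T * bool | e q.1.1 q.1.2].
pose F := k @: D.
have kP x y b : e x y ->
    same_vertex (p x) (k (x, y, b)) /\ same_vertex (p y) (flip0 (k (x, y, b))).
  by move=> /hP[h1 h2 _]; case: b; rewrite /k /= ?f20 ?same_vertexr2.
have k_ends x y b x' y' c : e x y -> e x' y' ->
    same_vertex (k (x, y, b)) (c) -> same_vertex (flip0 (k (x, y, b))) (flip0 c) ->
    same_vertex (p x') c -> same_vertex (p y') (flip0 c) -> x = x' /\ y = y'.
  move=> /(kP _ _ b)[h1 h2] _ s1 s2 s3 s4; split.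
    by apply: p_inj2 s3; apply: st s1.
  by apply: p_inj2 s4; apply: st s2.
have k_inj : {in D &, injective k}.
  move=> [[x y] b] [[x' y'] b']; rewrite !inE /= => xy xy' E.
  have [h1 h2] := kP _ _ b' xy'.
  have [E1 E2] : x = x' /\ y = y'.
    by apply: (k_ends x y b) h1 h2 => //; rewrite E same_vertex0.
  move: E; rewrite E1 E2; case: b; case: b' {h1 h2} => //=; rewrite /k /=.
    by move/flip2_free.
  by move/esym/flip2_free.
have cardF : #|F| = 2 * #|arcs e|.
  rewrite (card_in_imset k_inj); have -> : D = setX (arcs e) [set: bool].
    by apply/setP => -[[x y] b]; rewrite !inE andbT.
  by rewrite cardsX cardsT card_bool mulnC.
have k0 x y b : e x y -> flip0 (k (x, y, b)) = k (y, x, b).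
  by move=> /hP[_ _ E]; case: b; rewrite /k /= ?flip02C E.
have k2 x y b : flip2 (k (x, y, b)) = k (x, y, ~~ b).
  by case: b; rewrite /k /= ?flip2K.
have FP b : b \in F -> exists x y c, e x y /\ b = k (x, y, c).
  by case/imsetP => -[[x y] c]; rewrite inE /= => xy ->; exists x, y, c.
have kF x y b : e x y -> k (x, y, b) \in F.
  by move=> xy; apply: imset_f; rewrite inE.
have F0 b : b \in F -> flip0 b \in F.
  by case/FP => x [y [c [xy ->]]]; rewrite k0 // kF // e_sym.
have F2 b : b \in F -> flip2 b \in F.
  by case/FP => x [y [c [xy ->]]]; rewrite k2 kF.
have cF : edge_closed F.
  by split=> b; apply/idP/idP => /[dup]; [move/F0|move/F0|move/F2|move/F2];
    rewrite ?flip0K ?flip2K.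
have sF : simple_flags F.
  split=> [_ /FP[x [y [c [xy ->]]]]|_ _ /FP[x [y [c [xy ->]]]] /FP[x' [y' [c' [xy' ->]]]]].
    apply/negP => s1; have [h1 h2] := kP _ _ c xy.
    have E : x = y by apply: p_inj2 h2; apply: st s1.
    by rewrite E e_irr in xy.
  move=> s1 s2; have [h1 h2] := kP _ _ c' xy'.
  have [<- <-] := k_ends _ _ _ _ _ _ xy xy' s1 s2 h1 h2.
  by rewrite k2; case: c c' {s1 s2 h1 h2} => -[]; [left|right|right|left].
have F4 : 4 < #|F| by rewrite cardF; lia.
have Fn : F != set0 by rewrite -card_gt0; lia.
have leN : vertex_count F <= #|nonisolated e|.
  apply: leq_trans (leq_imset_card (fun x => cls (@same_vertex S) (p x)) _).
  apply/subset_leq_card/subsetP => _ /imsetP[_ /FP[x [y [c [xy ->]]]] ->].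
  apply/imsetP; exists x; first by rewrite inE (degree_gt0 xy).
  by apply/eqP; rewrite (cls_eqE _ _ (@vertex_step_sym S)) [connect _ _ _]sv; have [] := kP _ _ c xy.
have eu := euler_flags cF Fn; have r6 := region_count_simple cF sF F4.
split; first by lia.
move=> s sP; pose V b := [exists x, s x && same_vertex (p x) b].
have VE x b : same_vertex (p x) b -> V b = s x.
  move=> xb; apply/existsP/idP => [[y /andP[sy yb]]|sx]; last by exists x; rewrite sx.
  by rewrite (p_inj2 _ _ _ xb yb).
have V1 b : V (flip1 b) = V b by apply: eq_existsb => x; rewrite same_vertexr1.
have V2 b : V (flip2 b) = V b by apply: eq_existsb => x; rewrite same_vertexr2.
have V0 b : b \in F -> V (flip0 b) = ~~ V b.
  case/FP => x [y [c [xy ->]]]; have [h1 h2] := kP _ _ c xy.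
  by rewrite (VE _ _ h1) (VE _ _ h2); exact: sP.
have r8 := region_count_bipartite cF V1 V2 V0 sF F4; lia.
Qed.

(* The bipartite bound, for the graph of the edges meeting a vertex of degree at
   most [k]. *)
Lemma small_degree_sum e k t : symmetric e -> irreflexive e -> embeds_pos e ->
  k < t -> (forall x y, e x y -> degree e x <= k -> t <= degree e y) ->
  \sum_(x in nonisolated e | degree e x <= k) degree e x <=
  2 * (#|[set x in nonisolated e | degree e x <= k]| + #|[set x | t <= degree e x]|).
Proof.
move=> e_sym e_irr emb kt big.
pose e' := [rel x y | e x y && ((degree e x <= k) || (degree e y <= k))].
have sub : subrel e' e by move=> x y /andP[].
have sym' : symmetric e' by move=> x y; rewrite /= e_sym orbC.
have irr' : irreflexive e' by move=> x; rewrite /= e_irr.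
have nonisoE : #|nonisolated e'| <= #|[set x in nonisolated e | degree e x <= k]| +
    #|[set x | t <= degree e x]|.
  apply: leq_trans (leq_card_setU _ _); apply/subset_leq_card/subsetP => x.
  rewrite !inE card_gt0 => /set0Pn[y]; rewrite inE /= => /andP[xy].
  rewrite (degree_gt0 xy) /=; case/orP => [-> //|yk]; apply/orP; right.
  by apply: big yk; rewrite e_sym.
(* As [k < t], each edge of [e'] has exactly one end of degree at most [k]; the arcs leaving these
   ends form half of all arcs. *)
have cardE : #|arcs e'| = 2 * \sum_(x in nonisolated e | degree e x <= k) degree e x.
  pose A := [set q : T * T | e q.1 q.2 & degree e q.1 <= k].
  have cA : #|A| = \sum_(x in nonisolated e | degree e x <= k) degree e x.
    pose e1 := [rel x y | e x y && (degree e x <= k)].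
    have -> : A = arcs e1 by [].
    rewrite card_arcs [RHS]big_mkcond /=; apply: eq_bigr => x _; rewrite inE.
    case: (leqP (degree e x) k) => xk; rewrite ?andbT ?andbF; last first.
      by apply/eqP; rewrite cards_eq0; apply/eqP/setP => y; rewrite !inE /e1 /= leqNgt xk andbF.
    have -> : degree e1 x = degree e x.
      by apply: eq_card => y; rewrite !inE /e1 /= xk andbT.
    by case: posnP.
  have -> : arcs e' = A :|: [set (q.2, q.1) | q in A].
    apply/setP => -[x y]; rewrite !inE /= andb_orr; congr (_ || _).
    apply/idP/imsetP => [/andP[xy yk]|[[a b]]].
      by exists (y, x); rewrite ?inE //= e_sym xy.
    by rewrite inE /= => /andP[ab ak] [-> ->]; rewrite e_sym ab.
  rewrite cardsU card_imset => [|[a b] [a' b'] [-> ->] //].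
  have -> : A :&: [set (q.2, q.1) | q in A] = set0.
    apply/setP => -[x y]; rewrite !inE /=; apply/negbTE/negP => /andP[/andP[xy xk]].
    case/imsetP => -[a b]; rewrite inE /= => /andP[ab ak] [E1 E2].
    by have := big _ _ xy xk; rewrite E2; lia.
  by rewrite cards0 cA; lia.
case: (posnP #|arcs e'|) => [|D0]; first by rewrite cardE; lia.
have col x y : e' x y -> (degree e y <= k) = ~~ (degree e x <= k).
  case/andP=> xy; case: (leqP (degree e x) k) => xk //= _.
  by have := big _ _ xy xk; lia.
have [_ /(_ (fun x => degree e x <= k) col)] :=
  embedded_arcs sym' irr' (embeds_pos_sub sub emb) D0.
by rewrite cardE; lia.
Qed.

(** Without a light edge, the neighbours of vertices of degree at most 3, 4 and 5 have degree at
    least 12, 8 and 7. The three resulting instances of [small_degree_sum] contradict the bound on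
    all arcs. *)
Lemma light_edge e : symmetric e -> irreflexive e -> embeds_pos e ->
  0 < #|arcs e| ->
  exists u v, e u v /\
    [\/ degree e u <= 2, degree e u <= 3 /\ degree e v <= 11
      | degree e u <= degree e v /\ degree e u + degree e v <= 11].
Proof.
move=> e_sym e_irr emb D0; apply: contrapT => noLight.
have heavy x y : e x y ->
    [/\ 3 <= degree e x, degree e x <= 3 -> 12 <= degree e y
      & 12 <= degree e x + degree e y].
  move=> xy; have yx : e y x by rewrite e_sym.
  have h : ~ [\/ degree e x <= 2, degree e x <= 3 /\ degree e y <= 11
      | degree e x <= degree e y /\ degree e x + degree e y <= 11].
    by move=> h; apply: noLight; exists x, y.
  have h' : ~ [\/ degree e y <= 2, degree e y <= 3 /\ degree e x <= 11
      | degree e y <= degree e x /\ degree e y + degree e x <= 11].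
    by move=> h'; apply: noLight; exists y, x.
  split.
  - by rewrite ltnNge; apply/negP => k; apply: h; apply: Or31.
  - by move=> k; rewrite ltnNge; apply/negP => k'; apply: h; apply: Or32.
  - rewrite ltnNge; apply/negP => k; have [le|le] := leqP (degree e x) (degree e y).
      by apply: h; apply: Or33.
    by apply: h'; apply: Or33; lia.
have I k t : k < t -> t + k <= 12 \/ k = 3 /\ t = 12 ->
    (forall x y, e x y -> degree e x <= k -> t <= degree e y).
  move=> kt c x y /heavy[h1 h2 h3] xk; lia.
have [D6 _] := embedded_arcs e_sym e_irr emb D0.
have S5 := @small_degree_sum e 5 7 e_sym e_irr emb isT (I 5 7 isT (or_introl isT)).
have S4 := @small_degree_sum e 4 8 e_sym e_irr emb isT (I 4 8 isT (or_introl isT)).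
have S3 := @small_degree_sum e 3 12 e_sym e_irr emb isT
  (I 3 12 isT (or_intror (conj erefl erefl))).
have cond (P : pred T) (f : T -> nat) :
    \sum_(x in nonisolated e | P x) f x = \sum_(x in nonisolated e) P x * f x.
  by rewrite big_mkcondr /=; apply: eq_bigr => x _; case: (P x); rewrite ?mul1n.
have card_cond (P : pred T) :
    #|[set x in nonisolated e | P x]| = \sum_(x in nonisolated e) P x.
  rewrite -sum1_card; rewrite (eq_bigl (fun x => (x \in nonisolated e) && P x)).
    by rewrite cond; apply: eq_bigr => x _; rewrite muln1.
  by move=> x; rewrite inE.
have card_big t : 0 < t -> #|[set x | t <= degree e x]| =
    \sum_(x in nonisolated e) (t <= degree e x).
  move=> t0; rewrite -card_cond; apply: eq_card => x; rewrite !inE.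
  by case: (leqP t (degree e x)) => // h; rewrite ?andbT ?andbF //; lia.
have arcsE : #|arcs e| = \sum_(x in nonisolated e) degree e x.
  rewrite card_arcs [RHS]big_mkcond /=; apply: eq_bigr => x _.
  by rewrite inE; case: posnP.
have nonE : #|nonisolated e| = \sum_(x in nonisolated e) 1 by rewrite sum1_card.
rewrite !cond !card_cond !card_big // in S3 S4 S5; rewrite arcsE nonE in D6.
(* [W] and [U] collect the two sides of 3 * D6 + S5 + 2 * S4 + 6 * S3. *)
pose W x := 18 + 2 * (7 <= degree e x) + 4 * (8 <= degree e x) +
  12 * (12 <= degree e x) + 2 * (degree e x <= 5) + 4 * (degree e x <= 4) +
  12 * (degree e x <= 3).
pose U x := 3 * degree e x + (degree e x <= 5) * degree e x +
  2 * ((degree e x <= 4) * degree e x) + 6 * ((degree e x <= 3) * degree e x).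
(* From degree 3 on, [W] is at most [U], with equality at 3, 4, 5, 6, 8 and 12; the four bounds add
   up to the strict reverse inequality. *)
have : \sum_(x in nonisolated e) W x <= \sum_(x in nonisolated e) U x.
  apply: leq_sum => x; rewrite inE /W /U => dx.
  have : 3 <= degree e x.
    by move: dx; rewrite card_gt0 => /set0Pn[y]; rewrite inE => /heavy[].
  move: (degree e x) => n n3.
  case: (ltnP n 12) => n12; last by rewrite !(leq_trans _ n12) //; lia.
  by do 12?[case: n n3 n12 => // n n3 n12].
rewrite /W /U !big_split /= !big1_eq sum_nat_const.
rewrite sum1_card in D6; lia.
Qed.

End Graphs.

(** * Labelling from lists *)

Lemma fset_avoid (L : {fset int}) (bad : seq int) :
  size bad < #|` L|%fset -> exists2 z, (z \in L)%fset & z \notin bad.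
Proof.
move=> lt; apply/not_exists2P => H.
suff : size (L : seq int) <= size bad by rewrite cardfE in lt *; lia.
apply: uniq_leq_size (fset_uniq _) _ => z zL.
by have [/(_ zL)|/negP/negPn] := H z.
Qed.

(** The open interval of radius [d] around [c]: the labels that [c] forbids at an incident
    element. *)
Definition near (d : nat) (c : int) : seq int :=
  [seq (c + j%:Z + 1 - d%:Z)%R | j <- iota 0 (2 * d - 1)].

Lemma size_near d c : size (near d c) = 2 * d - 1.
Proof. by rewrite size_map size_iota. Qed.

Lemma notin_near d c z : z \notin near d c -> (d%:Z <= `|z - c|)%R.
Proof.
move=> zc; rewrite leNgt; apply: contra zc => lt; apply/mapP.
exists (absz (z - c - 1 + d%:Z)%R); last by lia.
by rewrite mem_iota; lia.
Qed.

Section Labelling.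

Variables (T : finType) (d : nat).
Implicit Types (e : rel T) (u v x y z : T).

Definition del e u v : rel T := fun x y => e x y && ([set x; y] != [set u; v]).

Lemma set2_eq x y u v : [set x; y] = [set u; v] ->
  (x = u /\ y = v) \/ (x = v /\ y = u).
Proof.
move=> E; have : x \in [set u; v] by rewrite -E set21.
have : y \in [set u; v] by rewrite -E set22.
have : u \in [set x; y] by rewrite E set21.
have : v \in [set x; y] by rewrite E set22.
by rewrite !inE => /orP[] /eqP ? /orP[] /eqP ? /orP[] /eqP ? /orP[] /eqP ?;
  subst; auto.
Qed.

Lemma set2_eql u y v : ([set u; y] == [set u; v]) = (y == v).
Proof.
by apply/eqP/eqP => [/set2_eq[[_ ->]|[-> ->]]|->].
Qed.

Lemma del_sub e u v : subrel (del e u v) e.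
Proof. by move=> x y /andP[]. Qed.

Lemma del_sym e u v : symmetric e -> symmetric (del e u v).
Proof. by move=> es x y; rewrite /del es setUC. Qed.

Lemma del_irr e u v : irreflexive e -> irreflexive (del e u v).
Proof. by move=> ei x; rewrite /del ei. Qed.

Lemma delC e u v : del e u v = del e v u.
Proof. by apply/funext => x; apply/funext => y; rewrite /del [[set u; v]]setUC. Qed.

Lemma degree_del e u v : e u v -> degree (del e u v) u = (degree e u).-1.
Proof.
move=> uv; rewrite /degree (cardsD1 v [set y | e u y]) inE uv /=.
by apply: eq_card => y; rewrite !inE /del set2_eql andbC.
Qed.

Lemma card_arcs_del e u v : e u v -> #|arcs (del e u v)| < #|arcs e|.
Proof.
move=> uv; apply: proper_card; apply/properP; split.
  by apply/subsetP => q; rewrite !inE => /del_sub.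
by exists (u, v); rewrite !inE //= /del eqxx andbF.
Qed.

(* [e0] is the adjacency relation constraining the vertex labels, [e] the set
   of edges that are labelled. *)
Definition labelling e0 e (Lv : T -> {fset int}) (Le : {set T} -> {fset int})
    (cv : T -> int) (ce : {set T} -> int) : Prop :=
  [/\ forall x, (cv x \in Lv x)%fset,
      forall x y, e x y -> (ce [set x; y] \in Le [set x; y])%fset,
      forall x y, e0 x y -> cv x <> cv y,
      forall x y z, e x y -> e x z -> y <> z -> ce [set x; y] <> ce [set x; z]
    & forall x y, e x y -> (d%:Z <= `|cv x - ce [set x; y]|)%R].

(** The common last step of all cases of the induction: [uv] receives [a] and [u] receives [x],
    which may be its old label, while all other labels stay. *)
Lemma labelling_extend e0 e Lv Le cv ce u v (x a : int) :
  symmetric e0 -> irreflexive e0 -> symmetric e -> irreflexive e -> e u v ->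
  labelling (del e0 u v) (del e u v) Lv Le cv ce ->
  (x \in Lv u)%fset -> (a \in Le [set u; v])%fset ->
  (forall y, e0 u y -> x <> cv y) ->
  (forall y, del e u v u y -> (d%:Z <= `|x - ce [set u; y]|)%R) ->
  (forall y, del e u v u y -> a <> ce [set u; y]) ->
  (forall y, del e u v v y -> a <> ce [set v; y]) ->
  (d%:Z <= `|x - a|)%R -> (d%:Z <= `|a - cv v|)%R ->
  labelling e0 e Lv Le (fun y => if y == u then x else cv y)
    (fun A => if A == [set u; v] then a else ce A).
Proof.
move=> es0 ei0 es ei uv [hLv hLe h0 hE hd] xL aL xe0 xe ae av xa va.
have uv' : u <> v by move=> E; rewrite E ei in uv.
split.
- by move=> y; case: eqP => [->|].
- move=> y z yz; case: eqP => [-> //|/eqP ne]; apply: hLe; by rewrite /del yz.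
- move=> y z yz; case: eqP => [Ey|ny]; case: eqP => [Ez|nz].
  + by rewrite Ey Ez ei0 in yz.
  + by rewrite Ey in yz; exact: xe0.
  + by rewrite Ez es0 in yz => E; exact: (xe0 _ yz).
  + apply: h0; rewrite /del yz; apply/eqP => /set2_eq[[]|[]] //.
- have key y z w : e y z -> e y w -> z <> w -> [set y; z] = [set u; v] ->
      [set y; w] != [set u; v] -> a <> ce [set y; w].
    move=> yz yw zw /set2_eq[[Ey Ez]|[Ey Ez]]; subst y => ne.
      by apply: ae; rewrite /del yw ne.
    by apply: av; rewrite /del yw ne.
  move=> y z w yz yw zw; case: eqP => [Ez|/eqP nz]; case: eqP => [Ew|/eqP nw].
  + by case: zw; apply/eqP; rewrite -(set2_eql y) Ez Ew.
  + exact: key Ez nw.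
  + by move/esym; apply: key Ew nz => //; apply: nesym.
  + by apply: hE => //; rewrite /del ?yz ?yw.
- move=> y z yz; case: (eqVneq [set y; z] [set u; v]) => [/set2_eq[[-> _]|[-> _]]|ne].
  + by rewrite eqxx.
  + by case: eqP => [/esym //|_]; rewrite distrC.
  + have yz' : del e u v y z by rewrite /del yz.
    case: eqP => [Ey|_]; last exact: hd.
    by rewrite Ey in yz' *; exact: xe.
Qed.

Lemma size_nbrs e x (f : T -> int) : size [seq f y | y in [set y | e x y]] = degree e x.
Proof. by rewrite size_image. Qed.

(** Greedy along a list: the next vertex avoids the labels of all its neighbours, listed so far or
    not. *)
Lemma vertex_labelling e0 (Lv : T -> {fset int}) :
  symmetric e0 -> irreflexive e0 -> (forall x, degree e0 x < #|` Lv x|%fset) ->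
  exists cv : T -> int, (forall x, (cv x \in Lv x)%fset) /\
    forall x y, e0 x y -> cv x <> cv y.
Proof.
move=> es ei big.
suff H (s : seq T) : exists cv : T -> int, (forall x, (cv x \in Lv x)%fset) /\
    forall x y, x \in s -> y \in s -> e0 x y -> cv x <> cv y.
  have [cv [h1 h2]] := H (enum T); exists cv; split=> // x y.
  by apply: h2; rewrite mem_enum.
elim: s => [|x s [cv [h1 h2]]].
  have /choice[cv h] : forall x, exists c, (c \in Lv x)%fset; last by exists cv.
  by move=> x; have [|z zL _] := @fset_avoid (Lv x) [::]; [exact: leq_trans (big x) | exists z].
have [|z zL zb] := @fset_avoid (Lv x) [seq cv y | y in [set y | e0 x y]].
  by rewrite size_nbrs.
have zn y : e0 x y -> z <> cv y.
  by move=> xy E; move/negP: zb; apply; rewrite E; apply: image_f; rewrite inE.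
exists (fun y => if y == x then z else cv y); split=> [y|y w].
  by case: eqP => [->|].
rewrite !inE; case: (eqVneq y x) => [->|nx]; case: (eqVneq w x) => [->|nw] //=.
- by rewrite ei.
- by move=> _ _ /zn.
- by move=> _ _; rewrite es => /zn h /esym.
- exact: h2.
Qed.

(* At a light edge [uv]: if [u] has at most three edges, [uv] is labelled first
   and [u] afterwards; if it has four, the other way round; if it has five or
   six, so has [v], and both keep their labels.  In the last case the
   adjacency of [u] and [v] has to be remembered when [uv] is deleted, which
   is why [e0] may be larger than [e]. *)
Lemma labelling_exists e0 e M (Lv : T -> {fset int}) (Le : {set T} -> {fset int}) :
  2 <= d -> 5 * d + 2 <= M ->
  symmetric e0 -> irreflexive e0 -> symmetric e -> subrel e e0 -> embeds_pos e ->
  (forall x, degree e x <= M) ->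
  (forall x y, e0 x y -> ~~ e x y -> degree e0 x <= 6) ->
  (forall x, #|` Lv x|%fset = M + 2 * d) ->
  (forall x y, e x y -> #|` Le [set x; y]|%fset = M + 2 * d) ->
  exists cv ce, labelling e0 e Lv Le cv ce.
Proof.
move=> d2 dM + + + + + + + cLv.
have [n] := ubnP #|arcs e|; elim: n e0 e => // n IH e0 e ltn es0 ei0 es sub emb
  maxd inv cLe.
have ei : irreflexive e by move=> x; apply/negP => /sub; rewrite ei0.
(* With no edge left to label, every vertex still constrained by [e0] has degree at most 6 there,
   and the greedy labelling applies. *)
have [E|D0] := posnP #|arcs e|.
  have e_0 x y : e x y = false.
    apply/negP => xy; move/eqP: E; rewrite cards_eq0 => /eqP/setP/(_ (x, y)).
    by rewrite !inE /= xy.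
  have [|cv [h1 h2]] := @vertex_labelling e0 Lv es0 ei0.
    move=> x; rewrite cLv; have [E0|[y]] := set_0Vmem [set y | e0 x y].
      by rewrite /degree E0 cards0; lia.
    rewrite inE => xy; have := inv x y xy; rewrite e_0 => /(_ isT); lia.
  by exists cv, (fun=> 0%R); split=> // x y; rewrite e_0.
have [u [v [uv light]]] := light_edge es ei emb D0.
have vu : e v u by rewrite es.
(* Either some [e0]-neighbour is joined to [x] by an edge outside [e], and the invariant applies, or
   all of them are [e]-neighbours. *)
have deg0 x : degree e0 x <= degree e x \/ degree e0 x <= 6.
  case: (boolP [exists y, e0 x y && ~~ e x y]) => [/existsP[y /andP[xy nxy]]|].
    by right; exact: inv nxy.
  move/existsPn => h; left; apply/subset_leq_card/subsetP => y; rewrite !inE => xy.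
  by have := h y; rewrite xy /= negbK.
set e' := del e u v.
have es' : symmetric e' by exact: del_sym.
have emb' : embeds_pos e' by exact: embeds_pos_sub (@del_sub e u v) emb.
have maxd' x : degree e' x <= M.
  by apply: leq_trans (maxd x); apply: leq_degree; exact: del_sub.
have cLe' x y : e' x y -> #|` Le [set x; y]|%fset = M + 2 * d.
  by move/del_sub; exact: cLe.
have lt' : #|arcs e'| < n by apply: leq_trans (card_arcs_del uv) _.
have du : degree e' u = (degree e u).-1 by exact: degree_del.
have dv : degree e' v = (degree e v).-1 by rewrite /e' delC; exact: degree_del.
have d0u := degree_gt0 uv; have d0v := degree_gt0 vu.
have cLuv := cLe _ _ uv; have cLu := cLv u; have dvM := maxd v.
(* For the cases where [u] is relabelled: the adjacency of [u] and [v] may be forgotten, as the new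
   label will avoid that of [v]. *)
have IHdel : exists cv ce, labelling (del e0 u v) e' Lv Le cv ce.
  apply: IH => //.
  - exact: del_sym.
  - exact: del_irr.
  - by move=> x y /andP[xy ne]; rewrite /del sub.
  - move=> x y /andP[xy ne]; rewrite /e' /del ne andbT => nxy.
    by apply: leq_trans (inv x y xy nxy); apply: leq_degree; exact: del_sub.
pose nb (c : {set T} -> int) x := [seq c [set x; y] | y in [set y | e' x y]].
have nbP c x y (z : int) : e' x y -> z \notin nb c x -> z <> c [set x; y].
  by move=> xy /negP h E; apply: h; rewrite E; apply: image_f; rewrite inE.
pose nb0 (c : T -> int) := [seq c y | y in [set y | e0 u y]].
have nb0P c y (z : int) : e0 u y -> z \notin nb0 c -> z <> c y.
  by move=> xy /negP h E; apply: h; rewrite E; apply: image_f; rewrite inE.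
pose nbd (c : {set T} -> int) := flatten [seq near d i | i <- nb c u].
have nbdP c y (z : int) : e' u y -> z \notin nbd c -> (d%:Z <= `|z - c [set u; y]|)%R.
  move=> uy /negP h; apply: notin_near; apply/negP => hz; apply: h.
  apply/flattenP; exists (near d (c [set u; y])) => //; apply: map_f.
  by apply: image_f; rewrite inE.
have size_nb c x : size (nb c x) = degree e' x by exact: size_nbrs.
have size_nb0 c : size (nb0 c) = degree e0 u by exact: size_nbrs.
have size_nbd c : size (nbd c) = degree e' u * (2 * d - 1).
  rewrite size_flatten /shape -map_comp; rewrite -(size_nb c u).
  elim: (nb c u) => //= z s IHs; rewrite size_near IHs; lia.
have d0 := deg0 u.
have [u3|u4] := leqP (degree e u) 3.
  have [cv [ce lab]] := IHdel.
  (* The label of [u] is ignored here. If d(u) <= 2, at most 1 + (M - 1) + (2d - 1) labels are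
     forbidden, even when d(v) = M; otherwise d(v) <= 11 and M >= 12 suffice. *)
  have [|a aL] := @fset_avoid (Le [set u; v]) (nb ce u ++ nb ce v ++ near d (cv v)).
    rewrite !size_cat !size_nb size_near cLuv du dv.
    by case: light => [l|[l l']|[l l']]; lia.
  rewrite !mem_cat !negb_or => /and3P[au av avd].
  (* At most six neighbours and three edges forbid 6 + 3(2d - 1) = 6d + 3 labels, fewer than 7d + 2
     since d >= 2. *)
  have [|x xL] := @fset_avoid (Lv u) (nb0 cv ++ nbd ce ++ near d a).
    rewrite !size_cat size_nb0 size_nbd size_near cLu du.
    have : (degree e u).-1 * (2 * d - 1) <= 2 * (2 * d - 1).
      by rewrite leq_mul2r; lia.
    by move=> ?; case: d0; lia.
  rewrite !mem_cat !negb_or => /and3P[x0 xd xa].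
  eexists; eexists; apply: labelling_extend uv lab xL aL _ _ _ _ _ _ => //.
  - by move=> y uy; exact: nb0P x0.
  - by move=> y uy; exact: nbdP.
  - by move=> y uy; exact: nbP au.
  - by move=> y uy; exact: nbP av.
  - exact: notin_near.
  - exact: notin_near.
have {light} [uv_le uv11] : degree e u <= degree e v /\ degree e u + degree e v <= 11.
  by case: light => [l|[l l']|//]; lia.
have [u4'|u5] := leqP (degree e u) 4.
  have [cv [ce lab]] := IHdel.
  have Eu : degree e u = 4 by lia.
  (* Again at most 6d + 3 forbidden labels, because [uv] is still unlabelled; a fourth labelled edge
     could exceed the room. Afterwards [uv] loses at most 3 + 6 + 2(2d - 1) = 4d + 7 labels. *)
  have [|x xL] := @fset_avoid (Lv u) (nb0 cv ++ nbd ce).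
    by rewrite !size_cat size_nb0 size_nbd cLu du Eu; case: d0; lia.
  rewrite !mem_cat !negb_or => /andP[x0 xd].
  have [|a aL] := @fset_avoid (Le [set u; v])
      (nb ce u ++ nb ce v ++ near d (cv v) ++ near d x).
    by rewrite !size_cat !size_nb !size_near cLuv du dv; lia.
  rewrite !mem_cat !negb_or => /and4P[au av avd ax].
  eexists; eexists; apply: labelling_extend uv lab xL aL _ _ _ _ _ _ => //.
  - by move=> y uy; exact: nb0P x0.
  - by move=> y uy; exact: nbdP.
  - by move=> y uy; exact: nbP au.
  - by move=> y uy; exact: nbP av.
  - by rewrite distrC; exact: notin_near.
  - exact: notin_near.
(* Both ends now have degree 5 or 6, so the invariant survives when [uv] leaves [e] but stays in
   [e0]. *)
have [cv [ce lab]] : exists cv ce, labelling e0 e' Lv Le cv ce.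
  apply: IH => //; first by move=> x y /del_sub/sub.
  move=> x y xy; rewrite /e' /del negb_and negbK => /orP[nxy|]; first exact: inv nxy.
  move=> /eqP/set2_eq[[-> _]|[-> _]].
    by case: d0; lia.
  by case: (deg0 v); lia.
have lab' : labelling (del e0 u v) e' Lv Le cv ce.
  by case: lab => ? ? h0 ? ?; split=> // x y /del_sub/h0.
(* At most nine adjacent edges and both ends forbid 9 + 2(2d - 1) = 4d + 7 labels, fewer than 7d +
   2. *)
have [|a aL] := @fset_avoid (Le [set u; v])
    (nb ce u ++ nb ce v ++ near d (cv v) ++ near d (cv u)).
  by rewrite !size_cat !size_nb !size_near cLuv du dv; lia.
rewrite !mem_cat !negb_or => /and4P[au av avd ax].
case: (lab) => hLv _ h0 _ hd.
eexists; eexists; apply: labelling_extend uv lab' (hLv u) aL _ _ _ _ _ _ => //.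
- by move=> y uy; exact: h0.
- by move=> y uy; exact: hd.
- by move=> y uy; exact: nbP au.
- by move=> y uy; exact: nbP av.
- by rewrite distrC; exact: notin_near.
- exact: notin_near.
Qed.

End Labelling.

(** * Total choosability of embedded graphs *)

Lemma edge_mem (G : sgraph) (x y : G) : adj x y -> [set x; y] \in edges G.
Proof. by move=> xy; apply/imsetP; exists (x, y); rewrite ?inE. Qed.

Lemma total_choosable_embedded (d : nat) (G : sgraph) (eps : int) (M : nat) :
  2 <= d -> (0 < eps)%R -> embeds_in_surface G eps -> 5 * d + 2 <= M ->
  max_degree G <= M -> total_choosable d G (M + 2 * d).
Proof.
move=> d2 eps0 [S [ES [p [p_inj pe]]]] dM degM L cL.
(* The induction indexes edge labels by vertex sets; sets that are not edges get the empty list. *)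
pose Le (A : {set G}) := if insub A is Some a then L (inr a) else fset0.
have LeE (a : edge G) : Le (val a) = L (inr a) by rewrite /Le valK.
have deg (x : G) : degree (@adj G) x <= M.
  by apply: leq_trans degM; exact: (leq_bigmax (F := fun x => degree (@adj G) x)).
have emb : embeds_pos (@adj G).
  by exists S; rewrite ES; split=> //; exists p.
have cLe x y : adj x y -> #|` Le [set x; y]|%fset = M + 2 * d.
  move=> xy; pose a : edge G := exist (fun A => A \in edges G) _ (edge_mem xy).
  by rewrite -(cL (inr a)) -LeE.
(* The induction starts with [e0 = e], where no deleted adjacency is remembered yet. *)
have inv (x y : G) : adj x y -> ~~ adj x y -> degree (@adj G) x <= 6 by move->.
have [cv [ce [h1 h2 h3 h4 h5]]] := labelling_exists d2 dM (@adj_sym G) (@adj_irr G)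
  (@adj_sym G) (fun _ _ h => h) emb deg inv (fun x => cL (inl x)) cLe.
have edgeP (a : edge G) u : u \in val a -> exists2 v, adj u v & val a = [set u; v].
  case: a => A /= /imsetP[[x y]]; rewrite inE /= => xy -> {A}.
  rewrite !inE => /orP[] /eqP->; first by exists y.
  by exists x; [rewrite adj_sym | rewrite setUC].
exists (fun z => match z with inl x => cv x | inr a => ce (val a) end).
split; last first.
  case=> [x|a] //; have [[x y]] := imsetP (valP a); rewrite inE /= => xy E.
  by rewrite -LeE /= E; exact: h2.
split=> [u v /h3 //|a b ab [u ua ub]|u a ua].
  have [v uv Ea] := edgeP a u ua; have [w uw Eb] := edgeP b u ub.
  rewrite [val a]Ea [val b]Eb; apply: h4 => // E.
  by apply: ab; apply: val_inj; rewrite [val a]Ea [val b]Eb E.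
by have [v uv Ea] := edgeP a u ua; rewrite [val a]Ea; exact: h5.
Qed.

Theorem theorem1p4 (d : nat) (G : sgraph) (eps : int) (M : nat) :
  2 <= d -> (0 < eps)%R -> embeds_in_surface G eps -> 5 * d + 2 <= M ->
  (max_degree G <= M -> total_choosability d G <= M + 2 * d) /\
  (max_degree G = M -> total_choosability d G <= max_degree G + 2 * d).
Proof.
move=> d2 eps0 emb dM.
have H : max_degree G <= M -> total_choosability d G <= M + 2 * d.
  move=> degM; rewrite /total_choosability; case: ex_minnP => k _ min_k.
  by apply/min_k/asboolP; exact: total_choosable_embedded emb dM degM.
by split=> // E; rewrite E; apply: H; rewrite E.
Qed.
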